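(* Let $s\in(0,n)$ be an integer, let $F=(f_1,\dots,f_d)\colon\mathbb{R}^n\to\mathbb{R}^d$, $g=(g_1,\dots,g_p)\colon\mathbb{R}^n\to\mathbb{R}^p$, $h=(h_1,\dots,h_q)\colon\mathbb{R}^n\to\mathbb{R}^q$, let $\Phi=\{x\in\mathbb{R}^n:g_i(x)\le0,\ i=1,\dots,p,\ h_j(x)=0,\ j=1,\dots,q\}$, $\mathcal S=\{x\in\mathbb{R}^n:\|x\|_0\le s\}$ and $\Omega=\Phi\cap\mathcal S$, and consider the multiobjective problem $\mathrm{Min}_{\mathbb{R}^d_+}F(x)$ subject to $x\in\Omega$. Let $\bar x\in\Omega$, suppose that $F$, $g$ and $h$ are of class $C^{1,1}$ around $\bar x$, and let $\bar x$ be an S-stationary point with $(\bar\alpha,\bar\lambda,\bar\mu)\in\mathrm A^S(\bar x)$. If for every $u\in[T_\Omega(\bar x)\cap\mathcal K(\bar x)]\setminus\{0_{\mathbb{R}^n}\}$ and for any $z\in\partial^2L^M(\bar x,\bar\alpha,\bar\lambda,\bar\mu)(u)$ one has $\langle z,u\rangle>0$, then $\bar x$ is an isolated local efficient solution of order $2$ of the multiobjective problem.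
   Context: Notation: $\|x\|_0$ is the number of nonzero components of $x$; $I(\bar x)=\{i\in\{1,\dots,p\}:g_i(\bar x)=0\}$. A real function is of class $C^{1,1}$ around $\bar x$ if on some open neighborhood of $\bar x$ it is Fréchet differentiable with locally Lipschitz gradient; for vector-valued maps this is required of each component. Solution concept: for $\bar x\in\Omega$ put $\varphi(x)=\max\{f_l(x)-f_l(\bar x):l\in\{1,\dots,d\}\}$. The point $\bar x$ is an isolated local efficient solution of order $2$ of the multiobjective problem if it is an isolated local solution of order $2$ of $\varphi$ on $\Omega$, i.e. there are $c>0$ and a neighborhood $U$ of $\bar x$ with $\varphi(x)\ge\varphi(\bar x)+\frac12c\|x-\bar x\|^2$ for all $x\in\Omega\cap U$. Lagrangian and multipliers: $L^M(x,\alpha,\lambda,\mu)=\langle\alpha,F(x)\rangle+\langle\lambda,g(x)\rangle+\langle\mu,h(x)\rangle$ for $x\in\mathbb{R}^n$, $\alpha\in\mathbb{R}^d_+\setminus\{0_{\mathbb{R}^d}\}$, $\lambda\in\mathbb{R}^p_+$, $\mu\in\mathbb{R}^q$; $\mathrm A^S(\bar x)=\{(\alpha,\lambda,\mu)\in(\mathbb{R}^d_+\setminus\{0_{\mathbb{R}^d}\})\times\mathbb{R}^p_+\times\mathbb{R}^q:-\nabla_xL^M(\bar x,\alpha,\lambda,\mu)\in\widehat N_{\mathcal S}(\bar x),\ \lambda_ig_i(\bar x)=0,\ i=1,\dots,p\}$. The point $\bar x$ is S-stationary if $\mathrm A^S(\bar x)\neq\emptyset$. Critical directions: $\mathcal K(\bar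 x)$ is the set of $u\in\mathbb{R}^n$ such that $\langle\nabla f_l(\bar x),u\rangle\le0$ for all $l=1,\dots,d$, $\langle\nabla f_l(\bar x),u\rangle=0$ for at least one $l\in\{1,\dots,d\}$, $\langle\nabla g_i(\bar x),u\rangle\le0$ for all $i\in I(\bar x)$, and $\langle\nabla h_j(\bar x),u\rangle=0$ for all $j=1,\dots,q$. For $X\subset\mathbb{R}^n$ and $\bar x\in X$, the contingent cone is $T_X(\bar x)=\{u:\exists t_k\to0^+,\ \exists u_k\to u,\ \bar x+t_ku_k\in X\ \forall k\}$. The Fréchet normal cone is $\widehat N_X(\bar x)=\{v:\limsup_{x\to\bar x,\,x\in X}\langle v,x-\bar x\rangle/\|x-\bar x\|\le0\}$, and the limiting normal cone $N_X(\bar x)$ is the set of all limits of sequences $v_k\in\widehat N_X(x_k)$ with $x_k\to\bar x$, $x_k\in X$. For $\psi$ of class $C^{1,1}$ around $\bar x$, the limiting (Mordukhovich) second-order subdifferential is $\partial^2\psi(\bar x)(u)=\{w\in\mathbb{R}^n:(w,-u)\in N_{\mathrm{gph}\,\nabla\psi}(\bar x,\nabla\psi(\bar x))\}$, which equals $\partial\langle u,\nabla\psi\rangle(\bar x)$, where $\partial\theta(\bar x)=\{v:(v,-1)\in N_{\mathrm{epi}\,\theta}(\bar x,\theta(\bar x))\}$ is the limiting subdifferential. $\partial^2L^M(\bar x,\bar\alpha,\bar\lambda,\bar\mu)(u)$ means $\partial^2\psi(\bar x)(u)$ for $\psi=L^M(\cdot,\bar\alpha,\bar\lambda,\bar\mu)$.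 *)

(* Defs.v *)
From HB Require Import structures.
From mathcomp Require Import all_boot all_order all_algebra.
From mathcomp Require Import all_classical all_reals all_analysis.

Set Implicit Arguments.
Unset Strict Implicit.
Unset Printing Implicit Defensive.

Import Order.TTheory GRing.Theory Num.Theory.
Import numFieldNormedType.Exports.

Local Open Scope classical_set_scope.
Local Open Scope ring_scope.

(* The norm `|x| on 'rV[R]_n is the max norm.  It is used only through notions
   that do not depend on the choice of a norm (convergence, differentiability,
   local Lipschitz continuity); wherever the value of a norm enters a formula,
   the Euclidean norm enorm is used. *)

Definition dot (R : realType) (n : nat) (u v : 'rV[R]_n) : R :=
  \sum_(i < n) u 0 i * v 0 i.

Definition enorm (R : realType) (n : nat) (x : 'rV[R]_n) : R :=
  Num.sqrt (dot x x).

Definition l0norm (R : realType) (n : nat) (x : 'rV[R]_n) : nat :=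
  #|[pred i | x 0 i != 0]|.

Definition grad (R : realType) (n : nat) (f : 'rV[R]_n -> R) (x : 'rV[R]_n) :
    'rV[R]_n :=
  \row_(i < n) 'd f x (delta_mx 0 i).

Definition C11_around (R : realType) (n : nat) (f : 'rV[R]_n -> R)
    (xbar : 'rV[R]_n) : Prop :=
  exists2 U : set 'rV[R]_n, open_nbhs xbar U &
    (forall x, U x -> differentiable f x) /\
    (forall x, U x ->
       exists2 V, nbhs x V & [lipschitz (grad f y) | y in V]).

Definition component (R : realType) (n m : nat) (F : 'rV[R]_n -> 'rV[R]_m)
    (i : 'I_m) : 'rV[R]_n -> R :=
  fun x => F x 0 i.

Definition C11_around_vec (R : realType) (n m : nat)
    (F : 'rV[R]_n -> 'rV[R]_m) (xbar : 'rV[R]_n) : Prop :=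
  forall i, C11_around (component F i) xbar.

Definition contingent_cone (R : realType) (n : nat) (X : set 'rV[R]_n)
    (xbar : 'rV[R]_n) : set 'rV[R]_n :=
  [set u | exists (t : nat -> R) (uk : nat -> 'rV[R]_n),
     [/\ forall k, 0 < t k, t @ \oo --> (0 : R), uk @ \oo --> u &
         forall k, X (xbar + t k *: uk k)]].

(* If xbar is isolated in X the limsup is -oo, and the cone is the whole space. *)
Definition frechet_normal_cone (R : realType) (n : nat) (X : set 'rV[R]_n)
    (xbar : 'rV[R]_n) : set 'rV[R]_n :=
  [set v | (limf_esup
              (fun x : 'rV[R]_n => (dot v (x - xbar) / enorm (x - xbar))%:E)
              (within X xbar^') <= 0)%E].

Definition limiting_normal_cone (R : realType) (n : nat) (X : set 'rV[R]_n)
    (xbar : 'rV[R]_n) : set 'rV[R]_n :=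
  [set v | exists xk vk : nat -> 'rV[R]_n,
     [/\ forall k, X (xk k), xk @ \oo --> xbar,
         forall k, frechet_normal_cone X (xk k) (vk k) & vk @ \oo --> v]].

(* R^n x R^n is represented by 'rV[R]_(n + n), the pair (x, y) by row_mx x y.
   Points where psi is not differentiable, where grad psi is meaningless, are
   left out of the graph. *)
Definition gph_grad (R : realType) (n : nat) (psi : 'rV[R]_n -> R) :
    set 'rV[R]_(n + n) :=
  [set row_mx x (grad psi x) | x in [set x | differentiable psi x]].

Definition subdiff2 (R : realType) (n : nat) (psi : 'rV[R]_n -> R)
    (xbar u : 'rV[R]_n) : set 'rV[R]_n :=
  [set w | limiting_normal_cone (gph_grad psi)
             (row_mx xbar (grad psi xbar)) (row_mx w (- u))].

Definition Phi_set (R : realType) (n p q : nat) (g : 'rV[R]_n -> 'rV[R]_p)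
    (h : 'rV[R]_n -> 'rV[R]_q) : set 'rV[R]_n :=
  [set x | (forall i, g x 0 i <= 0) /\ (forall j, h x 0 j = 0)].

Definition sparse_set (R : realType) (n s : nat) : set 'rV[R]_n :=
  [set x | (l0norm x <= s)%N].

Definition Omega_set (R : realType) (n s p q : nat)
    (g : 'rV[R]_n -> 'rV[R]_p) (h : 'rV[R]_n -> 'rV[R]_q) : set 'rV[R]_n :=
  Phi_set g h `&` @sparse_set R n s.

Definition LM (R : realType) (n d p q : nat) (F : 'rV[R]_n -> 'rV[R]_d)
    (g : 'rV[R]_n -> 'rV[R]_p) (h : 'rV[R]_n -> 'rV[R]_q)
    (alpha : 'rV[R]_d) (lambda : 'rV[R]_p) (mu : 'rV[R]_q) :
    'rV[R]_n -> R :=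
  fun x => dot alpha (F x) + dot lambda (g x) + dot mu (h x).

Definition S_multipliers (R : realType) (n s d p q : nat)
    (F : 'rV[R]_n -> 'rV[R]_d) (g : 'rV[R]_n -> 'rV[R]_p)
    (h : 'rV[R]_n -> 'rV[R]_q) (xbar : 'rV[R]_n) :
    set ('rV[R]_d * 'rV[R]_p * 'rV[R]_q) :=
  [set m : 'rV[R]_d * 'rV[R]_p * 'rV[R]_q |
     let: (alpha, lambda, mu) := m in
     [/\ (forall l, 0 <= alpha 0 l) /\ alpha != 0,
         forall i, 0 <= lambda 0 i,
         frechet_normal_cone (@sparse_set R n s) xbar
           (- grad (LM F g h alpha lambda mu) xbar) &
         forall i, lambda 0 i * g xbar 0 i = 0]].

Definition S_stationary (R : realType) (n s d p q : nat)
    (F : 'rV[R]_n -> 'rV[R]_d) (g : 'rV[R]_n -> 'rV[R]_p)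
    (h : 'rV[R]_n -> 'rV[R]_q) (xbar : 'rV[R]_n) : Prop :=
  S_multipliers s F g h xbar !=set0.

Definition critical_cone (R : realType) (n d p q : nat)
    (F : 'rV[R]_n -> 'rV[R]_d) (g : 'rV[R]_n -> 'rV[R]_p)
    (h : 'rV[R]_n -> 'rV[R]_q) (xbar : 'rV[R]_n) : set 'rV[R]_n :=
  [set u | [/\ forall l, dot (grad (component F l) xbar) u <= 0,
               exists l, dot (grad (component F l) xbar) u = 0,
               forall i, g xbar 0 i = 0 -> dot (grad (component g i) xbar) u <= 0 &
               forall j, dot (grad (component h j) xbar) u = 0]].

Definition isolated_local_solution2 (R : realType) (n : nat)
    (phi : 'rV[R]_n -> R) (Omega : set 'rV[R]_n) (xbar : 'rV[R]_n) : Prop :=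
  exists2 c : R, 0 < c &
    exists2 U : set 'rV[R]_n, nbhs xbar U &
      forall x, (Omega `&` U) x ->
        phi xbar + 2^-1 * c * enorm (x - xbar) ^+ 2 <= phi x.

(* A maximum over a nonempty index set, hence the codomain 'rV[R]_d.+1. *)
Definition max_increment (R : realType) (n d : nat)
    (F : 'rV[R]_n -> 'rV[R]_d.+1) (xbar x : 'rV[R]_n) : R :=
  \big[Num.max/F x 0 ord0 - F xbar 0 ord0]_(l < d.+1) (F x 0 l - F xbar 0 l).

Definition isolated_local_efficient2 (R : realType) (n d : nat)
    (F : 'rV[R]_n -> 'rV[R]_d.+1) (Omega : set 'rV[R]_n) (xbar : 'rV[R]_n) :
    Prop :=
  isolated_local_solution2 (max_increment F xbar) Omega xbar.

(* Main.v *)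
(* If xbar is not isolated, there are feasible x = xbar + t u with |u| = 1,
   t -> 0, along which every f_l increases by at most o(t^2); hence so does the
   Lagrangian L.  Near xbar the segment from xbar to x stays in the sparse set,
   so <grad L(xbar), u> >= 0 and L(x) - L(xbar) - t <grad L(xbar), u> <= o(t^2).
   By the mean value theorem <grad L(xbar + s u) - grad L(xbar), u> <= o(1) s for
   some 0 < s < t.  A penalized minimization turns this inequality for the
   Lipschitz function <grad L, u> into a bounded proximal subgradient v of it,
   at a point near xbar, with <v, u> <= o(1).  A limit point (u, z) of the pairs
   (u, v) satisfies z \in d^2 L(xbar)(u) and <z, u> <= 0, while u is a nonzero
   tangent critical direction: a contradiction. *)
Require Import Defs.
From HB Require Import structures.
From mathcomp Require Import all_boot all_order all_algebra.
From mathcomp Require Import all_classical all_reals all_analysis.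
From mathcomp Require Import ring lra.

Set Implicit Arguments.
Unset Strict Implicit.
Unset Printing Implicit Defensive.

Import Order.TTheory GRing.Theory Num.Theory.
Import numFieldNormedType.Exports.

Local Open Scope classical_set_scope.
Local Open Scope ring_scope.

(** * Scalar product, Euclidean norm and max norm *)

Section Dot.
Context {R : realType} {n : nat}.
Implicit Types u v w : 'rV[R]_n.

Lemma dotC u v : dot u v = dot v u.
Proof. by apply: eq_bigr => i _; rewrite mulrC. Qed.

Lemma dotDl u v w : dot (u + v) w = dot u w + dot v w.
Proof. by rewrite -big_split; apply: eq_bigr => i _; rewrite mxE mulrDl. Qed.

Lemma dotZl c u v : dot (c *: u) v = c * dot u v.
Proof. by rewrite mulr_sumr; apply: eq_bigr => i _; rewrite mxE mulrA. Qed.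

Lemma dotNl u v : dot (- u) v = - dot u v.
Proof. by rewrite -scaleN1r dotZl mulN1r. Qed.

Lemma dotBl u v w : dot (u - v) w = dot u w - dot v w.
Proof. by rewrite dotDl dotNl. Qed.

Lemma dotDr u v w : dot u (v + w) = dot u v + dot u w.
Proof. by rewrite !(dotC u) dotDl. Qed.

Lemma dotZr c u v : dot u (c *: v) = c * dot u v.
Proof. by rewrite !(dotC u) dotZl. Qed.

Lemma dotNr u v : dot u (- v) = - dot u v.
Proof. by rewrite !(dotC u) dotNl. Qed.

Lemma dotBr u v w : dot u (v - w) = dot u v - dot u w.
Proof. by rewrite dotDr dotNr. Qed.

Lemma dot0l v : dot 0 v = 0.
Proof. by rewrite -[0](scale0r v) dotZl mul0r. Qed.

Lemma dot_ge0 u : 0 <= dot u u.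
Proof. by apply: sumr_ge0 => i _; rewrite -expr2 sqr_ge0. Qed.

Lemma coord_le_norm u i : `|u 0 i| <= `|u|.
Proof.
rewrite [leRHS]mx_normrE; apply: (le_bigmax _ (fun ij => `|u ij.1 ij.2|) (0, i)).
Qed.

(** A substitute for Cauchy-Schwarz in the max norm: each of the [n] products is at most the product
    of the norms. *)
Lemma norm_dot_le u v : `|dot u v| <= n%:R * `|u| * `|v|.
Proof.
apply: le_trans (ler_norm_sum _ _ _) _.
have -> : n%:R * `|u| * `|v| = \sum_(i < n) `|u| * `|v|.
  by rewrite sumr_const card_ord -[RHS]mulr_natl mulrA.
by apply: ler_sum => i _; rewrite normrM ler_pM ?coord_le_norm.
Qed.

Lemma norm_sqr_le_dot u : `|u| ^+ 2 <= dot u u.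
Proof.
have [[i hi]|] : (exists i, `|u| = `|u 0 i|) \/ `|u| = 0.
  have [->|/mx_norm_neq0[[a i] /= hi]] := eqVneq (`|u|) 0; first by right.
  by left; exists i; rewrite [LHS]hi ord1.
- rewrite hi real_normK ?num_real// /dot (bigD1 i)//= -expr2 lerDl.
  by apply: sumr_ge0 => j _; rewrite -expr2 sqr_ge0.
- by move=> ->; rewrite expr0n dot_ge0.
Qed.

Lemma enorm_sqr u : enorm u ^+ 2 = dot u u.
Proof. by rewrite sqr_sqrtr// dot_ge0. Qed.

Lemma enorm_sqr_le u : enorm u ^+ 2 <= n%:R * `|u| ^+ 2.
Proof. by rewrite enorm_sqr expr2 mulrA; apply: le_trans (ler_norm _) (norm_dot_le _ _). Qed.

Lemma norm_le_enorm u : `|u| <= enorm u.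
Proof.
by rewrite -(@ler_pXn2r _ 2)// ?nnegrE ?sqrtr_ge0// enorm_sqr norm_sqr_le_dot.
Qed.

Lemma cvg_dot {T : Type} {G : set_system T} {FG : Filter G} (f g : T -> 'rV[R]_n) u v :
  f @ G --> u -> g @ G --> v -> dot (f x) (g x) @[x --> G] --> dot u v.
Proof.
move=> fu gv; apply: cvg_big => [|i _]; [exact: add_continuous|apply: cvgM].
- exact: (cvg_comp f _ fu (@coord_continuous _ _ _ _ _ _)).
- exact: (cvg_comp g _ gv (@coord_continuous _ _ _ _ _ _)).
Qed.

End Dot.

Lemma dot_row_mx {R : realType} {n m : nat} (u u' : 'rV[R]_n) (v v' : 'rV[R]_m) :
  dot (row_mx u v) (row_mx u' v') = dot u u' + dot v v'.
Proof.
rewrite /dot big_split_ord /=; congr (_ + _); apply: eq_bigr => i _.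
- by rewrite !row_mxEl.
- by rewrite !row_mxEr.
Qed.

(** * Gradients *)

Section Gradient.
Context {R : realType} {n : nat}.
Implicit Types (f : 'rV[R]_n -> R) (a x u v w : 'rV[R]_n).

Lemma diff_grad f x v : 'd f x v = dot (grad f x) v.
Proof.
rewrite {1}(row_sum_delta v) linear_sum; apply: eq_bigr => i _.
by rewrite linearZ mxE mulrC.
Qed.

Lemma gradD f1 f2 x : differentiable f1 x -> differentiable f2 x ->
  grad (f1 \+ f2) x = grad f1 x + grad f2 x.
Proof. by move=> d1 d2; apply/rowP => i; rewrite !mxE diffD. Qed.

Lemma gradZ c f x : differentiable f x -> grad (c \*: f) x = c *: grad f x.
Proof. by move=> df; apply/rowP => i; rewrite !mxE diffZ. Qed.

Lemma grad_cst c x : grad (cst c) x = 0.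
Proof. by apply/rowP => i; rewrite !mxE diff_cst. Qed.

Lemma first_order f a : differentiable f a -> forall e : R, 0 < e ->
  exists2 r : R, 0 < r & forall w, `|w| < r ->
    `|f (a + w) - f a - dot (grad f a) w| <= e * `|w|.
Proof.
move=> df e e0; have /eqaddoP/(_ e e0) := diff_locally df.
rewrite nearE /= => /nbhs_normP[r /= r0 H].
exists r => // w wr; have /= := H w; rewrite sub0r normrN => /(_ wr).
by rewrite -diff_grad !fctE /= opprD addrA (addrC w).
Qed.

(** A difference quotient along [w] close to [u] differs from the derivative along [u] by a
    vanishing error. This turns increments that are small relative to [t] at nearby feasible points
    into the sign conditions of the critical cone. *)
Lemma first_order_sign f a u : differentiable f a ->
  (forall e : R, 0 < e -> exists (t : R) w,
    [/\ 0 < t < e, `|w - u| < e & f (a + t *: w) - f a <= e * t]) ->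
  dot (grad f a) u <= 0.
Proof.
move=> df H; apply/ler_addgt0Pr => /= e e0; rewrite add0r.
(* Three errors, each a multiple of [d]: the assumed increment (1), the first-order remainder
   ([|w|], at most [|u| + 1]), and the replacement of [w] by [u]. *)
pose C : R := 1 + (`|u| + 1) + n%:R * `|grad f a|.
have C1 : 1 <= C by rewrite /C -addrA lerDl !addr_ge0// mulr_ge0.
have C0 : 0 < C by apply: lt_le_trans C1.
pose d := Num.min 1 (e / C).
have d0 : 0 < d by rewrite lt_min ltr01 divr_gt0.
have d1 : d <= 1 by rewrite ge_min lexx.
have [r r0 hr] := first_order df d0.
have m0 : 0 < Num.min d (r / (`|u| + 1)).
  by rewrite lt_min d0 divr_gt0// ltr_wpDl.
have [t [w [/andP[t0 tm] wu hf]]] := H _ m0.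
have wu1 : `|w - u| < d by apply: lt_le_trans wu _; rewrite ge_min lexx.
have wn : `|w| <= `|u| + 1.
  by rewrite -(subrK u w) addrC (le_trans (ler_normD _ _))// lerD2l; lra.
have tr : `|t *: w| < r.
  rewrite normrZ gtr0_norm//; apply: (@le_lt_trans _ _ (t * (`|u| + 1))).
    by rewrite ler_pM2l.
  by rewrite -ltr_pdivlMr ?ltr_wpDl//; apply: lt_le_trans tm _; rewrite ge_min lexx orbT.
have fd : f (a + t *: w) - f a <= d * t.
  by apply: le_trans hf _; rewrite ler_pM2r// ge_min lexx.
have := hr _ tr; rewrite ler_norml => /andP[h1 _].
rewrite normrZ gtr0_norm// dotZr in h1.
have h2 : t * dot (grad f a) w <= t * (d * (1 + (`|u| + 1))).
  have : d * (t * `|w|) <= d * (t * (`|u| + 1)) by rewrite !ler_pM2l.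
  lra.
rewrite ler_pM2l// in h2.
have h3 : dot (grad f a) u - dot (grad f a) w <= n%:R * `|grad f a| * d.
  rewrite -dotBr; apply: le_trans (ler_norm _) _; apply: le_trans (norm_dot_le _ _) _.
  by rewrite distrC ler_wpM2l ?mulr_ge0// ltW.
have : d * C <= e by rewrite -ler_pdivlMr// ge_min lexx orbT.
by rewrite /C; lra.
Qed.

Lemma is_derive_segment f a u (t : R) : differentiable f (a + t *: u) ->
  is_derive t 1 (fun s : R => f (a + s *: u)) (dot (grad f (a + t *: u)) u).
Proof.
move=> df; have E : (fun h : R => h^-1 *: (f (a + (h *: 1 + t) *: u) - f (a + t *: u))) =
    (fun h : R => h^-1 *: (f (h *: u + (a + t *: u)) - f (a + t *: u))).
  by apply/funext => h; rewrite scaler1 scalerDl addrCA.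
split.
- by have := diff_derivable (v:=u) df; rewrite /derivable /= -E.
- by rewrite -diff_grad -deriveE// /derive /= -E.
Qed.

End Gradient.

(** * Functions with Lipschitz gradient near a point *)

Section LipschitzGradient.
Context {R : realType} {n : nat}.
Implicit Types (f : 'rV[R]_n -> R) (a x : 'rV[R]_n).

Definition C11_ball f a (r K : R) : Prop :=
  (forall x, `|x - a| < r -> differentiable f x) /\
  (forall x y, `|x - a| < r -> `|y - a| < r ->
     `|grad f x - grad f y| <= K * `|x - y|).

(** One radius and one Lipschitz constant make the property easy to carry over to sums and
    multiples, hence to the Lagrangian. *)
Definition C11_near f a : Prop :=
  exists r K : R, [/\ 0 < r, 0 <= K & C11_ball f a r K].

Lemma C11_around_near f a : C11_around f a -> C11_near f a.
Proof.
move=> [U [oU Ua] [dU lU]].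
have [V Va lV] := lU _ Ua.
have /nbhs_normP[r /= r0 rUV] : nbhs a (U `&` V).
  by apply: filterI => //; apply: open_nbhs_nbhs.
have sub x : `|x - a| < r -> U x /\ V x by rewrite distrC => /rUV.
have [K0 [_ HK]] := lV.
(* The Lipschitz bound holds for every constant strictly above [K0]; this one is also
   nonnegative. *)
pose K := Num.max K0 0 + 1.
exists r, K; split => //; first by rewrite addr_ge0// le_max lexx orbT.
split => [x /sub[Ux _]|x y /sub[_ Vx] /sub[_ Vy]]; first exact: dU.
have KK : K0 < K by rewrite /K ltr_pwDr// le_max lexx.
by have := HK K KK (x, y); apply.
Qed.

Lemma C11_near_cst a c : C11_near (cst c) a.
Proof.
exists 1, 0; split => //; split => [x _|x y _ _]; first exact: differentiable_cst.
by rewrite !grad_cst subrr normr0 mul0r.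
Qed.

Lemma C11_nearD f1 f2 a : C11_near f1 a -> C11_near f2 a -> C11_near (f1 \+ f2) a.
Proof.
move=> [r1 [K1 [r10 K10 [d1 l1]]]] [r2 [K2 [r20 K20 [d2 l2]]]].
exists (Num.min r1 r2), (K1 + K2); split.
- by rewrite lt_min r10.
- exact: addr_ge0.
- split => [x|x y]; rewrite !lt_min.
    by move=> /andP[/d1 ? /d2 ?]; apply: differentiableD.
  move=> /andP[x1 x2] /andP[y1 y2].
  rewrite !gradD; [|by auto..].
  by rewrite opprD addrACA mulrDl (le_trans (ler_normD _ _))// lerD ?l1 ?l2.
Qed.

Lemma C11_nearZ c f a : C11_near f a -> C11_near (c \*: f) a.
Proof.
move=> [r [K [r0 K0 [df lf]]]]; exists r, (`|c| * K); split => //.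
  exact: mulr_ge0.
split => [x /df ?|x y xa ya]; first exact: differentiableZ.
rewrite !gradZ; [|by auto..].
by rewrite -scalerBr normrZ -mulrA ler_wpM2l// lf.
Qed.

Lemma dot_component m (c : 'rV[R]_m) (F : 'rV[R]_n -> 'rV[R]_m) :
  (fun x => dot c (F x)) = \sum_(i < m) (c 0 i \*: component F i).
Proof. by apply/funext => x; rewrite fct_sumE. Qed.

Lemma C11_near_dot m (c : 'rV[R]_m) (F : 'rV[R]_n -> 'rV[R]_m) a :
  (forall i, C11_near (component F i) a) -> C11_near (fun x => dot c (F x)) a.
Proof.
move=> hF; rewrite dot_component; elim/big_ind : _ => [|f1 f2|i _].
- exact: C11_near_cst.
- exact: C11_nearD.
- exact: C11_nearZ.
Qed.

Lemma C11_near_differentiable f a : C11_near f a -> differentiable f a.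
Proof. by move=> [r [K [r0 _ [df _]]]]; apply: df; rewrite subrr normr0. Qed.

Lemma differentiable_dot m (c : 'rV[R]_m) (F : 'rV[R]_n -> 'rV[R]_m) a :
  (forall i, differentiable (component F i) a) ->
  differentiable (fun x => dot c (F x)) a /\
  grad (fun x => dot c (F x)) a = \sum_(i < m) c 0 i *: grad (component F i) a.
Proof.
move=> dF; rewrite dot_component.
elim/big_ind2 : _ => [|f1 G1 f2 G2 [d1 <-] [d2 <-]|i _].
- by split; [exact: differentiable_cst|exact: grad_cst].
- by split; [exact: differentiableD|exact: gradD].
- by split; [exact: differentiableZ|exact: gradZ].
Qed.

Lemma dot_suml m (G : 'I_m -> 'rV[R]_n) u :
  dot (\sum_i G i) u = \sum_i dot (G i) u.
Proof.
by apply: (big_morph (fun v => dot v u)) => [v w|]; [exact: dotDl|exact: dot0l].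
Qed.

Lemma dot_grad_dot m (c : 'rV[R]_m) (F : 'rV[R]_n -> 'rV[R]_m) a u :
  (forall i, differentiable (component F i) a) ->
  dot (grad (fun x => dot c (F x)) a) u =
  \sum_(i < m) c 0 i * dot (grad (component F i) a) u.
Proof.
move=> /(differentiable_dot c)[_ ->]; rewrite dot_suml.
by apply: eq_bigr => i _; rewrite dotZl.
Qed.

(** Subtract from [f (a + s *: u)] its linear part and [e * s ^+ 2]. The resulting [phi] does not
    increase between 0 and [t], so its derivative is nonpositive at some intermediate [s]. *)
Lemma C11_near_mean_value f a r K u (t e : R) : C11_ball f a r K ->
  0 < t -> t * `|u| < r ->
  f (a + t *: u) - f a - t * dot (grad f a) u <= e * t ^+ 2 ->
  exists2 s, 0 < s < t &
    dot (grad f (a + s *: u)) u - dot (grad f a) u <= 2 * e * s.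
Proof.
move=> [df _] t0 tr hf.
have inb s : 0 <= s <= t -> `|a + s *: u - a| < r.
  move=> /andP[s0 st]; rewrite addrC addKr normrZ ger0_norm//.
  by apply: le_lt_trans tr; rewrite ler_wpM2r.
pose phi (s : R) := f (a + s *: u) - (s * dot (grad f a) u + e * s ^+ 2).
pose dphi (s : R) := dot (grad f (a + s *: u)) u - (dot (grad f a) u + 2 * e * s).
have dphiP s : 0 <= s <= t -> is_derive s 1 phi (dphi s).
  move=> /inb/df/(@is_derive_segment _ _ _ _ u) H.
  have Q := is_deriveD (is_deriveZ (dot (grad f a) u) (is_derive_id s (1 : R)))
    (is_deriveZ e (is_deriveM (is_derive_id s (1 : R)) (is_derive_id s 1))).
  have -> : phi = (fun s => f (a + s *: u)) - (dot (grad f a) u \*: id + e \*: (id * id)).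
    by apply/funext => x; rewrite /phi !fctE /=; congr (_ - _); rewrite /GRing.scale /=; ring.
  apply: (is_derive_eq (is_deriveB H Q)).
  by rewrite /dphi; congr (_ - _); rewrite /GRing.scale /=; ring.
have [||s] := @MVT _ phi dphi 0 t t0.
- by move=> s; rewrite in_itv /= => /andP[s0 st]; apply: dphiP; rewrite !ltW.
- apply: continuous_in_subspaceT => s; rewrite inE /= in_itv /= => /dphiP[ds _].
  by apply: differentiable_continuous; apply/derivable1_diffP.
- rewrite in_itv /= => st; rewrite subr0 => E; exists s => //.
  have : dphi s * t <= 0.
    by rewrite -E /phi scale0r addr0 mul0r expr0n /= mulr0 addr0 subr0; lra.
  by rewrite pmulr_lle0// /dphi subr_le0 lerBlDl.
Qed.

End LipschitzGradient.

(** * Normal cones and the sparse set *)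

Section NormalCones.
Context {R : realType} {n : nat}.
Implicit Types (X : set 'rV[R]_n) (a v w x : 'rV[R]_n).

Lemma rV_norm_le v (b : R) : 0 <= b -> (forall i, `|v 0 i| <= b) -> `|v| <= b.
Proof.
move=> b0 h; rewrite [leLHS]mx_normrE; apply/bigmax_leP; split => // -[i j] _ /=.
by rewrite ord1.
Qed.

Lemma enormZ (c : R) v : enorm (c *: v) = `|c| * enorm v.
Proof. by rewrite /enorm dotZl dotZr mulrA -expr2 sqrtrM ?sqr_ge0// sqrtr_sqr. Qed.

Lemma enorm_le v : enorm v <= n%:R * `|v|.
Proof.
rewrite -(@ler_pXn2r _ 2)// ?nnegrE ?sqrtr_ge0 ?mulr_ge0//.
apply: le_trans (enorm_sqr_le _) _; rewrite exprMn ler_wpM2r ?exprn_ge0//.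
by rewrite -natrX ler_nat; case: (n) => // m; rewrite expnS leq_pmulr// expn1.
Qed.

(** The quotient in the definition of the cone is constant along the segment, with value
    [dot v w / enorm w], so the limsup bounds it by 0. *)
Lemma frechet_normal_segment X a v w : frechet_normal_cone X a v ->
  (forall t, 0 < t <= 1 -> X (a + t *: w)) -> dot v w <= 0.
Proof.
move=> vX segX; have [->|w0] := eqVneq w 0; first by rewrite dotC dot0l.
have nw0 : 0 < `|w| by rewrite normr_gt0.
have ew0 : 0 < enorm w by apply: lt_le_trans nw0 (norm_le_enorm _).
apply/ler_addgt0Pr => /= e e0; rewrite add0r.
have ew : 0 < e / enorm w by rewrite divr_gt0.
have /ereal_inf_lt[_ [A AX <-]] : (limf_esup
   (fun x : 'rV[R]_n => (dot v (x - a) / enorm (x - a))%:E)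
   (within X a^') < (e / enorm w)%:E)%E by apply: le_lt_trans vX _; rewrite lte_fin.
move=> supA; have {AX} /nbhs_normP[r /= r0 hr] : nbhs a [set x | x != a -> X x -> A x].
  exact: AX.
pose t := Num.min 1 (r / (2 * `|w|)).
have t0 : 0 < t by rewrite lt_min ltr01 divr_gt0// mulr_gt0.
have tr : t * `|w| < r.
  have : t * (2 * `|w|) <= r by rewrite -ler_pdivlMr ?mulr_gt0// ge_min lexx orbT.
  lra.
have Aa : A (a + t *: w).
  apply: hr.
  - by rewrite /= opprD addNKr normrN normrZ gtr0_norm.
  - by rewrite -subr_eq0 addrC addKr scaler_eq0 negb_or w0 gt_eqF.
  - by apply: segX; rewrite t0 ge_min lexx.
have : ((dot v (t *: w) / enorm (t *: w))%:E <= (e / enorm w)%:E)%E.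
  apply: le_trans (ltW supA); apply: ereal_sup_ubound; exists (a + t *: w) => //=.
  by rewrite [a + _]addrC addrK.
rewrite lee_fin enormZ dotZr gtr0_norm// -mulf_div divff ?gt_eqF// mul1r.
by rewrite ler_pM2r// invr_gt0.
Qed.

(** After division by [enorm (x - a)] the quadratic bound becomes [N * enorm (x - a)], which tends
    to 0. *)
Lemma proximal_frechet_normal X a v (N r : R) : 0 < r ->
  (forall x, X x -> `|x - a| < r -> dot v (x - a) <= N * dot (x - a) (x - a)) ->
  frechet_normal_cone X a v.
Proof.
move=> r0 h; rewrite /frechet_normal_cone /= /limf_esup.
apply/lee_addgt0Pr => /= e e0; rewrite add0e.
pose B := [set x | X x /\ `|N| * enorm (x - a) <= e].
apply: (@le_trans _ _ (ereal_sup
  [set (dot v (x - a) / enorm (x - a))%:E | x in B `&` ball a r])).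
  apply: ereal_inf_lbound; exists (B `&` ball a r) => //.
  have C0 : 0 < `|N| * n%:R + 1 by rewrite ltr_pwDr// mulr_ge0.
  have : nbhs a (ball a (e / (`|N| * n%:R + 1)) `&` ball a r).
    by apply: filterI; apply: nbhsx_ballx => //; rewrite divr_gt0.
  apply: filterS => x [xe xr] _ Xx; split => //; split => //.
  apply: (@le_trans _ _ (`|N| * (n%:R * `|x - a|))).
    by rewrite ler_wpM2l// enorm_le.
  move: xe; rewrite -ball_normE /= distrC ltr_pdivlMr// => /ltW.
  apply: le_trans.
  by rewrite mulrA [leRHS]mulrC ler_wpM2r// lerDl.
apply/ereal_supP => _ [x [[Xx xe] xr] <-]; rewrite lee_fin.
(* [B] may contain [a] itself, where division by zero gives the quotient the value 0. *)
have [E|E] := eqVneq (enorm (x - a)) 0.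
  by rewrite E invr0 mulr0 ltW.
have E0 : 0 < enorm (x - a) by rewrite lt_def E sqrtr_ge0.
rewrite ler_pdivrMr//.
move: xr; rewrite -ball_normE /= distrC => /(h _ Xx) xN.
apply: le_trans xN _; rewrite -enorm_sqr expr2 mulrA ler_pM2r//.
by apply: le_trans xe; rewrite ler_wpM2r ?sqrtr_ge0// ler_norm.
Qed.

(** Near [a] the nonzero coordinates of [a] stay nonzero, so the support of [x] contains that of [a]
    and hence that of every point of the segment. *)
Lemma sparse_segment s a : \forall x \near a,
  sparse_set s x -> forall t, 0 < t <= 1 -> sparse_set s (a + t *: (x - a)).
Proof.
have : nbhs a [set x : 'rV[R]_n | forall i, a 0 i != 0 -> x 0 i != 0].
  apply: (@filter_forall _ _ (fun i (x : 'rV[R]_n) => a 0 i != 0 -> x 0 i != 0)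
    (nbhs a)) => i.
  have [ai|ai] := eqVneq (a 0 i) 0; first by apply: nearW => x /eqP[].
  have : nbhs a [set x : 'rV[R]_n | x 0 i != 0].
    have oN : nbhs (a 0 i) [set y : R | y != 0].
      by apply: open_nbhs_nbhs; split; [exact: open_neq|].
    exact: (@coord_continuous R 1 n 0 i a _ oN).
  by apply: filterS.
apply: filterS => x hx; rewrite /sparse_set /= => xs t _.
apply: leq_trans xs; apply: subset_leq_card; apply/fintype.subsetP => i.
rewrite !inE !mxE; apply: contraNneq => xi; move: (hx i).
by rewrite xi eqxx; case: eqVneq => [-> _|_ /(_ isT)//]; rewrite subrr mulr0 addr0.
Qed.

End NormalCones.

Lemma norm_row_mx_le {R : realType} {n m : nat} (u : 'rV[R]_n) (v : 'rV[R]_m) :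
  `|row_mx u v| <= `|u| + `|v|.
Proof.
apply: rV_norm_le => [|i]; first exact: addr_ge0.
case: (split_ordP i) => j ->; rewrite ?row_mxEl ?row_mxEr.
- by apply: le_trans (coord_le_norm _ _) _; rewrite lerDl.
- by apply: le_trans (coord_le_norm _ _) _; rewrite lerDr.
Qed.

Lemma norm_row_mx_ge {R : realType} {n m : nat} (u : 'rV[R]_n) (v : 'rV[R]_m) :
  `|u| <= `|row_mx u v|.
Proof.
apply: rV_norm_le => // i.
by have := coord_le_norm (row_mx u v) (lshift m i); rewrite row_mxEl.
Qed.

(** * A proximal mean value inequality *)

Section MeanValueInequality.
Context {R : realType} {n : nat}.
Implicit Types (theta : 'rV[R]_n -> R) (a u v x : 'rV[R]_n).

Lemma compact_norm_ball a (r : R) : compact [set x : 'rV[R]_n | `|x - a| <= r].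
Proof.
apply: bounded_closed_compact.
  exists (r + `|a|); split; first exact: num_real.
  move=> M rM x /= xr; apply: le_trans (ltW rM).
  by rewrite -(subrK a x) (le_trans (ler_normD _ _))// lerD2r.
have -> : [set x : 'rV[R]_n | `|x - a| <= r] = closed_ball_ Num.Def.normr a r.
  by apply/seteqP; split => x; rewrite /closed_ball_ /= distrC.
exact: closed_closed_ball_.
Qed.

(* v is read off a minimizer (c, s) of
   theta x - e * s + N * |x - (a + s *: u)|^2, the quadratic penalization of the
   minimization of theta (a + s *: u) - e * s over 0 <= s <= tau. *)
Lemma proximal_mean_value theta a r (K tau e eta : R) u :
  0 <= K ->
  (forall x y, `|x - a| < r -> `|y - a| < r ->
     `|theta x - theta y| <= K * `|x - y|) ->
  0 < tau -> tau * `|u| < r -> theta (a + tau *: u) - theta a < e * tau ->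
  0 < eta ->
  exists c v (N d : R),
    [/\ 0 < d, `|c - a| < Num.min r (tau * `|u| + eta), `|v| <= 2 * K, dot v u <= e &
        forall x, `|x - c| < d ->
          dot v (x - c) <= theta x - theta c + N * dot (x - c) (x - c)].
Proof.
move=> K0 lip tau0 taur hm eta0.
(* The closed ball of radius [rho] contains the segment and stays inside the region where [theta] is
   Lipschitz. [mu] is the allowed distance of the minimizer from the segment, and [m] is the slack
   in the strict hypothesis. *)
pose rho := (tau * `|u| + r) / 2.
pose mu := Num.min eta (rho - tau * `|u|).
pose m := e * tau - (theta (a + tau *: u) - theta a).
have m0 : 0 < m by rewrite subr_gt0.
have mu0 : 0 < mu by rewrite lt_min eta0 /rho; lra.
have rhor : rho < r by rewrite /rho; lra.
(* The penalty must satisfy [K < N * mu], which keeps [c] inside the ball, and [K ^+ 2 < N * m],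
   which excludes [s = 0]. *)
pose N := K / mu + K ^+ 2 / m + 1.
have q1 : 0 <= K / mu by rewrite divr_ge0// ltW.
have q2 : 0 <= K ^+ 2 / m by rewrite divr_ge0 ?sqr_ge0// ltW.
have N0 : 0 < N by rewrite /N; lra.
have Nmu : K < N * mu by rewrite -ltr_pdivrMr// /N; lra.
have Nm : K ^+ 2 < N * m by rewrite -ltr_pdivrMr// /N; lra.
pose A : set ('rV[R]_n * R) := [set x | `|x - a| <= rho] `*` `[0, tau].
pose Y (p : 'rV[R]_n * R) := p.1 - (a + p.2 *: u).
pose q (p : 'rV[R]_n * R) := theta p.1 - e * p.2 + N * dot (Y p) (Y p).
have rho0 : 0 <= rho.
  rewrite /rho divr_ge0// addr_ge0 ?mulr_ge0 ?(ltW tau0)//.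
  by apply: le_trans (ltW taur); rewrite mulr_ge0// ltW.
have Aseg s : 0 <= s <= tau -> A (a + s *: u, s).
  move=> /andP[s0 st]; split; last by rewrite /= in_itv /= s0.
  rewrite /= addrC addKr normrZ ger0_norm//.
  apply: (@le_trans _ _ (tau * `|u|)); first by rewrite ler_wpM2r.
  by rewrite /rho; lra.
have cq : {within A, continuous q}.
  apply: continuous_in_subspaceT => p; rewrite inE => -[/= pr _].
  have c1 : {for p, continuous (fun z : 'rV[R]_n * R => theta z.1)}.
    apply: (@continuous_comp _ _ _ fst theta); first exact: cvg_fst.
    have : theta x @[x --> nbhs p.1] --> theta p.1; last exact.
    apply/cvgrPdist_lt => /= eps eps0.
    have K1 : 0 < K + 1 by rewrite ltr_wpDl.
    have : nbhs p.1 (ball p.1 (r - rho) `&` ball p.1 (eps / (K + 1))).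
      by apply: filterI; apply: nbhsx_ballx; rewrite ?subr_gt0 ?divr_gt0.
    rewrite -ball_normE; apply: filterS => x /= [xr xe].
    have xa : `|x - a| < r.
      rewrite -(subrK p.1 x) -addrA (le_lt_trans (ler_normD _ _))// distrC.
      by rewrite -(subrK rho r) ltr_leD.
    apply: le_lt_trans (lip _ _ (le_lt_trans pr rhor) xa) _.
    apply: (@le_lt_trans _ _ ((K + 1) * `|p.1 - x|)).
      by rewrite ler_wpM2r// lerDl.
    by rewrite mulrC -ltr_pdivlMr.
  have c2 : {for p, continuous Y}.
    apply: cvgB; first exact: cvg_fst.
    by apply: cvgD; [exact: cvg_cst|apply: cvgZr_tmp; exact: cvg_snd].
  apply: cvgD; first apply: cvgB => //.
    by apply: cvgM; [exact: cvg_cst|exact: cvg_snd].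
  by apply: cvgM; [exact: cvg_cst|apply: cvg_dot].
have cA : compact A.
  by apply: compact_setX; [exact: compact_norm_ball|exact: segment_compact].
have A0 : A !=set0 by exists (a + tau *: u, tau); apply: Aseg; rewrite lexx ltW.
have [[c s] cs min] := compact_EVT_min A0 cA cq.
have {}min p : A p -> q (c, s) <= q p by move=> Ap; apply: min; rewrite inE.
have [/= cr sI] : A (c, s) by rewrite inE in cs.
have /andP[s0 st] : 0 <= s <= tau by move: sI; rewrite in_itv.
have [y ysE] : exists y, y = c - (a + s *: u) by exists (c - (a + s *: u)).
have qE : q (c, s) = theta c - e * s + N * dot y y by rewrite ysE.
have sux : `|a + s *: u - a| <= tau * `|u|.
  by rewrite addrC addKr normrZ ger0_norm// ler_wpM2r.
(* Compare the minimizer with [(a + s *: u, s)], where the penalty vanishes. *)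
have Ny : N * `|y| <= K.
  have [->|y0] := eqVneq (`|y|) 0; first by rewrite mulr0.
  have yp : 0 < `|y| by rewrite lt_def y0 normr_ge0.
  have h1 := min _ (Aseg s _); rewrite s0 st in h1; move/(_ isT): h1.
  rewrite qE {1}/q /Y /= subrr dot0l mulr0 addr0.
  have h2 : theta (a + s *: u) - theta c <= K * `|y|.
    apply: le_trans (ler_norm _) _; rewrite distrC ysE; apply: lip.
      exact: le_lt_trans cr rhor.
    exact: le_lt_trans sux taur.
  have h3 : N * `|y| ^+ 2 <= N * dot y y by rewrite ler_pM2l// norm_sqr_le_dot.
  move=> h1; rewrite -(ler_pM2r yp) -mulrA -expr2; lra.
have ymu : `|y| < mu.
  by rewrite -(ltr_pM2l N0); apply: le_lt_trans Ny Nmu.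
have ca : `|c - a| < tau * `|u| + mu.
  have -> : c - a = (a + s *: u - a) + y.
    by rewrite [RHS]addrC ysE addrA subrK.
  by apply: le_lt_trans (ler_normD _ _) _; apply: ler_ltD.
have mue : mu <= eta by rewrite ge_min lexx.
have mur : mu <= rho - tau * `|u| by rewrite ge_min lexx orbT.
have crho : `|c - a| < rho by lra.
(* If [s = 0], comparison with the end of the segment gives [N * |y|^2 - K * |y| <= - m], whereas
   the left side is at least [- K^2 / (4 N)]. *)
have sp : 0 < s.
  rewrite lt_def s0 andbT; apply/eqP => s00.
  have h1 := min _ (Aseg tau _); rewrite lexx (ltW tau0) in h1; move/(_ isT): h1.
  have yE : y = c - a by rewrite ysE s00 scale0r addr0.
  rewrite qE {1}/q /Y /= subrr dot0l s00 !mulr0 addr0 subr0 => h1.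
  have h2 : theta a - theta c <= K * `|y|.
    rewrite yE distrC; apply: le_trans (ler_norm _) _; apply: lip.
      by rewrite subrr normr0; apply: le_lt_trans taur; rewrite mulr_ge0// ltW.
    exact: le_lt_trans cr rhor.
  have h3 : N * `|y| ^+ 2 <= N * dot y y by rewrite ler_pM2l// norm_sqr_le_dot.
  have h4 : N * `|y| ^+ 2 - K * `|y| <= - m by rewrite /m; lra.
  have h5 : 4 * N * (N * `|y| ^+ 2 - K * `|y|) <= 4 * N * (- m).
    by rewrite ler_pM2l// mulr_gt0.
  have := sqr_ge0 (2 * N * `|y| - K); nra.
(* [v] is minus the gradient at [c] of the penalty, and the last radius keeps [x] in the ball of
   radius [rho]. *)
exists c, (- (2 * N) *: y), N, (rho - `|c - a|); split.
- by rewrite subr_gt0.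
- by rewrite lt_min (lt_trans crho)//=; lra.
- by rewrite normrZ normrN gtr0_norm ?mulr_gt0// -mulrA ler_pM2l.
(* Vary [s] alone. It may equal [tau], so it is only decreased, by a small [k]; this is possible
   because [s > 0] and gives the one-sided bound on [dot v u]. *)
- apply/ler_addgt0Pr => /= eps eps0.
  pose D := N * dot u u + 1.
  have D0 : 0 < D by rewrite /D ltr_wpDl// mulr_ge0 ?dot_ge0// ltW.
  pose k := Num.min s (eps / D).
  have k0 : 0 < k by rewrite lt_min sp divr_gt0.
  have ks : k <= s by rewrite ge_min lexx.
  have kD : k * D <= eps by rewrite -ler_pdivlMr// ge_min lexx orbT.
  have : A (c, s - k).
    split => //=; rewrite in_itv /= subr_ge0 ks /=.
    by apply: le_trans st; rewrite lerBlDr lerDl ltW.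
  move=> /min; rewrite qE /q /Y /=.
  have -> : c - (a + (s - k) *: u) = y + k *: u.
    by rewrite ysE scalerBl !opprD opprK !addrA.
  rewrite dotDl !dotDr !dotZl !dotZr (dotC u y) => h.
  have h' : - (2 * N) * dot y u * k <= (e + k * (N * dot u u)) * k by lra.
  rewrite ler_pM2r// in h'.
  apply: le_trans h' _; rewrite lerD2l; apply: le_trans kD.
  by rewrite ler_pM2l// lerDl.
(* Vary the point alone, with [s] fixed, and expand the square. *)
- move=> x xc; have : A (x, s).
    split => //=; rewrite -(subrK c x) -addrA (le_trans (ler_normD _ _))//.
    by rewrite -lerBrDr ltW.
  move=> /min; rewrite qE /q /Y /=.
  have -> : x - (a + s *: u) = y + (x - c) by rewrite [RHS]addrC ysE addrA subrK.
  move: (x - c) => z; rewrite dotDl !dotDr dotZl (dotC z y); lra.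
Qed.

End MeanValueInequality.

(** * Limiting second-order subdifferential *)

Section SecondOrder.
Context {R : realType} {n : nat}.
Implicit Types (psi : 'rV[R]_n -> R) (a u v w z c : 'rV[R]_n).

(* A Frechet (here proximal) subgradient v of x |-> <grad psi x, u> at c yields
   the normal (v, -u) to the graph of grad psi at (c, grad psi c). *)
Lemma small_second_difference psi a : C11_near psi a -> exists M r : R,
  [/\ 0 <= M, 0 < r & forall u (t e : R), `|u| = 1 -> 0 < t < r -> 0 < e ->
    psi (a + t *: u) - psi a - t * dot (grad psi a) u <= e * t ^+ 2 ->
    exists c v, [/\ `|c - a| < t /\ differentiable psi c,
      `|grad psi c - grad psi a| <= M * t, `|v| <= M, dot v u <= 3 * e &
      frechet_normal_cone (gph_grad psi)
        (row_mx c (grad psi c)) (row_mx v (- u))]].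
Proof.
move=> [r [K [r0 K0 CK]]]; have [df lf] := CK.
have nK0 : 0 <= n%:R * K by rewrite mulr_ge0.
(* [K] controls the gradient gap; [2 * (n * K)] controls [v], since [theta] below has Lipschitz
   constant [n * K]. *)
exists (K + 2 * (n%:R * K)), r; split => //; first by rewrite addr_ge0// mulr_ge0.
move=> u t e u1 /andP[t0 tr] e0.
have tur : t * `|u| < r by rewrite u1 mulr1.
move=> /(C11_near_mean_value CK t0 tur)[s /andP[s0 st] hs].
pose theta x := dot (grad psi x) u.
have lip x y : `|x - a| < r -> `|y - a| < r ->
    `|theta x - theta y| <= n%:R * K * `|x - y|.
  move=> xa ya; rewrite -dotBl; apply: le_trans (norm_dot_le _ _) _.
  by rewrite u1 mulr1 -mulrA ler_wpM2l// lf.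
have sur : s * `|u| < r by rewrite u1 mulr1 (lt_trans st).
(* The proximal inequality needs a strict bound, so 2 is raised to 3. *)
have hm : theta (a + s *: u) - theta a < 3 * e * s.
  have es : 0 < e * s by rewrite mulr_gt0.
  by apply: le_lt_trans hs _; rewrite -subr_gt0 -!mulrA -mulrBl; lra.
have ts0 : 0 < t - s by rewrite subr_gt0.
(* The tolerance [t - s] places [c] within [s + (t - s) = t] of [a]. *)
have [c [v [N [d [d0 + vK vu hv]]]]] := proximal_mean_value nK0 lip s0 sur hm ts0.
rewrite u1 mulr1 subrKC lt_min => /andP[cr ct].
exists c, v; split => //.
- by split => //; apply: df.
- apply: le_trans (lf _ _ cr _) _; first by rewrite subrr normr0.
  apply: (@le_trans _ _ (K * t)); first by rewrite ler_wpM2l// ltW.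
  by rewrite ler_wpM2r ?(ltW t0)// lerDl mulr_ge0.
- by apply: le_trans vK _; rewrite lerDr.
(* Moving the increment of [theta] to the left gives a proximal normal inequality on the graph; the
   squared gradient difference only enlarges the right side once [N] is replaced by [|N|]. *)
- apply: (@proximal_frechet_normal _ _ _ _ _ `|N| d) => // _ [x dx <-].
  rewrite opp_row_mx add_row_mx => xd; rewrite !dot_row_mx.
  have /hv : `|x - c| < d by apply: le_lt_trans xd; apply: norm_row_mx_ge.
  rewrite /theta -dotBl dotNl (dotC u) => h.
  have h1 : N * dot (x - c) (x - c) <= `|N| * dot (x - c) (x - c).
    by rewrite ler_wpM2r ?dot_ge0 ?ler_norm.
  rewrite mulrDr -[leLHS]addr0 lerD ?mulr_ge0 ?dot_ge0//.
  by rewrite lerBlDl; apply: le_trans h _; rewrite lerD2l.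
Qed.

Lemma subdiff2_limit psi a u z (ck vk uk : nat -> 'rV[R]_n) :
  (forall k, differentiable psi (ck k)) ->
  ck @ \oo --> a -> (fun k => grad psi (ck k)) @ \oo --> grad psi a ->
  vk @ \oo --> z -> uk @ \oo --> u ->
  (forall k, frechet_normal_cone (gph_grad psi)
     (row_mx (ck k) (grad psi (ck k))) (row_mx (vk k) (- uk k))) ->
  subdiff2 psi a u z.
Proof.
have cvg_row (x y : nat -> 'rV[R]_n) b c : x @ \oo --> b -> y @ \oo --> c ->
    (fun k => row_mx (x k) (y k)) @ \oo --> row_mx b c.
  move=> xb yc; apply/cvgrPdist_lt => e e0; near=> k.
  rewrite opp_row_mx add_row_mx; apply: le_lt_trans (norm_row_mx_le _ _) _.
  rewrite (splitr e); apply: ltrD; near: k.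
  - by apply: cvgr_dist_lt; rewrite ?divr_gt0.
  - by apply: cvgr_dist_lt; rewrite ?divr_gt0.
move=> dk ca ga vz uu hk.
exists (fun k => row_mx (ck k) (grad psi (ck k))), (fun k => row_mx (vk k) (- uk k)).
split => //.
- by move=> k; exists (ck k) => //; apply: dk.
- exact: cvg_row.
- by apply: cvg_row => //; apply: cvgN.
Unshelve. all: by end_near. Qed.

End SecondOrder.

(** * Convergent sequences of approximate solutions *)

Lemma cvg_inv_succ {R : realType} {V : normedModType R} (u : nat -> V) a :
  (forall k, `|u k - a| < k.+1%:R^-1) -> u @ \oo --> a.
Proof.
move=> h; apply/cvgrPdist_lt => e e0; near=> k.
rewrite distrC; apply: lt_trans (h k) _; near: k.
exact: near_infty_natSinv_lt (PosNum e0).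
Unshelve. all: by end_near. Qed.

(** Points chosen for the tolerances [1/(k+1)] cluster at some [p0]. By monotonicity a whole tail
    satisfies [P] at level [k], so some such point lies within [1/(k+1)] of [p0]; no subsequence
    needs to be indexed. *)
Lemma compact_extraction {R : realType} {T : pseudoMetricType R} (A : set T)
    (P : R -> T -> Prop) : compact A ->
  (forall e e' p, e <= e' -> P e p -> P e' p) ->
  (forall e, 0 < e -> exists2 p, A p & P e p) ->
  exists2 p0, A p0 &
    exists2 y : nat -> T, y @ \oo --> p0 & forall k, P k.+1%:R^-1 (y k).
Proof.
move=> cA mono ex.
have inv0 k : 0 < (k.+1%:R^-1 : R) by rewrite invr_gt0.
have /choice[y hy] : forall k : nat, exists p, A p /\ P k.+1%:R^-1 p.
  by move=> k; have [p ? ?] := ex _ (inv0 k); exists p.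
have [|p0 [Ap0 cl]] := cA (y @ \oo) _.
  by exists 0%N => // k _; have [] := hy k.
exists p0 => //.
have /choice[y' hy'] : forall k : nat, exists p, P k.+1%:R^-1 p /\ ball p0 k.+1%:R^-1 p.
  move=> k; apply: (cl [set p | P k.+1%:R^-1 p] (ball p0 k.+1%:R^-1)); last first.
    exact: nbhsx_ballx.
  exists k => // j kj; have [_] := hy j; apply: mono.
  by rewrite lef_pV2 ?posrE// ler_nat ltnS.
exists y' => [|k]; last by have [] := hy' k.
apply/cvg_ballP => e e0; near=> k; have [_] := hy' k.
apply: le_ball; apply: ltW; near: k; exact: near_infty_natSinv_lt (PosNum e0).
Unshelve. all: by end_near. Qed.

Lemma first_order_sign_seq {R : realType} {n : nat} (f : 'rV[R]_n -> R) a u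
    (t : nat -> R) (uk : nat -> 'rV[R]_n) : differentiable f a ->
  (forall k, 0 < t k < k.+1%:R^-1) -> uk @ \oo --> u ->
  (forall k, f (a + t k *: uk k) - f a <= k.+1%:R^-1 * t k) ->
  dot (grad f a) u <= 0.
Proof.
move=> df tk uu fk; apply: first_order_sign => // e e0.
have [k [ke ku]] : exists k : nat, k.+1%:R^-1 < e /\ `|uk k - u| < e.
  near (\oo : set_system nat) => k; exists k; split; near: k.
    exact: near_infty_natSinv_lt (PosNum e0).
  by near=> k; rewrite distrC; near: k; apply: cvgr_dist_lt.
have /andP[t0 tk1] := tk k.
exists (t k), (uk k); split => //; first by rewrite t0 (lt_trans tk1).
by apply: le_trans (fk k) _; rewrite ler_wpM2r// ltW.
Unshelve. all: by end_near. Qed.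

(** * The Lagrangian *)

Section Multipliers.
Context {R : realType} {n d p q : nat} (F : 'rV[R]_n -> 'rV[R]_d) (g : 'rV[R]_n -> 'rV[R]_p)
  (h : 'rV[R]_n -> 'rV[R]_q) (a : 'rV[R]_n)
  (alpha : 'rV[R]_d) (lambda : 'rV[R]_p) (mu : 'rV[R]_q).

Lemma C11_near_LM : (forall i, C11_near (component F i) a) ->
  (forall i, C11_near (component g i) a) ->
  (forall i, C11_near (component h i) a) -> C11_near (LM F g h alpha lambda mu) a.
Proof.
move=> hF hg hh.
exact: (C11_nearD (C11_nearD (C11_near_dot alpha hF) (C11_near_dot lambda hg))
  (C11_near_dot mu hh)).
Qed.

Lemma dot_grad_LM u : (forall i, differentiable (component F i) a) ->
  (forall i, differentiable (component g i) a) ->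
  (forall i, differentiable (component h i) a) ->
  dot (grad (LM F g h alpha lambda mu) a) u =
  \sum_i alpha 0 i * dot (grad (component F i) a) u +
  \sum_i lambda 0 i * dot (grad (component g i) a) u +
  \sum_i mu 0 i * dot (grad (component h i) a) u.
Proof.
move=> dF dg dh; rewrite -!dot_grad_dot// -!dotDl; congr dot.
have [d1 _] := differentiable_dot alpha dF.
have [d2 _] := differentiable_dot lambda dg.
have [d3 _] := differentiable_dot mu dh.
by rewrite -(gradD d1 d2) -(gradD (differentiableD d1 d2) d3).
Qed.

(** By complementarity the inequality term vanishes at [a]; it is nonpositive at the feasible [x],
    and the equality terms vanish at both. Only the objectives contribute. *)
Lemma LM_increment_le x (b : R) : (forall i, 0 <= alpha 0 i) ->
  (forall i, 0 <= lambda 0 i) -> (forall i, lambda 0 i * g a 0 i = 0) ->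
  Phi_set g h a -> Phi_set g h x -> (forall i, F x 0 i - F a 0 i <= b) ->
  LM F g h alpha lambda mu x - LM F g h alpha lambda mu a <=
    (\sum_i alpha 0 i) * b.
Proof.
move=> al0 la0 compl [ga ha] [gx hx] Fb.
have h0 y : (forall j, h y 0 j = 0) -> dot mu (h y) = 0.
  by move=> hy; apply: big1 => i _; rewrite hy mulr0.
have g0 : dot lambda (g a) = 0 by apply: big1 => i _; exact: compl.
have gx0 : dot lambda (g x) <= 0.
  by apply: sumr_le0 => i _; rewrite mulr_ge0_le0.
rewrite /LM !h0// g0 !addr0.
have : dot alpha (F x) - dot alpha (F a) <= (\sum_i alpha 0 i) * b.
  rewrite -dotBr mulr_suml; apply: ler_sum => i _.
  by rewrite !mxE ler_wpM2l.
lra.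
Qed.

(* A positive multiplier cannot weigh a strictly decreasing objective, since the
   Lagrangian does not decrease along u. *)
Lemma critical_direction u :
  (forall i, differentiable (component F i) a) ->
  (forall i, differentiable (component g i) a) ->
  (forall i, differentiable (component h i) a) ->
  (forall i, 0 <= alpha 0 i) -> alpha != 0 ->
  (forall i, 0 <= lambda 0 i) -> (forall i, lambda 0 i * g a 0 i = 0) ->
  (forall i, dot (grad (component F i) a) u <= 0) ->
  (forall i, g a 0 i = 0 -> dot (grad (component g i) a) u <= 0) ->
  (forall i, dot (grad (component h i) a) u = 0) ->
  0 <= dot (grad (LM F g h alpha lambda mu) a) u ->
  critical_cone F g h a u.
Proof.
move=> dF dg dh al0 aln la0 compl uF ug uh; rewrite dot_grad_LM// => L0.
split => //.
have [l al] : exists l, alpha 0 l != 0.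
  apply/existsP; apply: contraNT aln; rewrite negb_exists => /forallP al.
  by apply/eqP/rowP => l; rewrite mxE; apply/eqP; rewrite -[_ == _]negbK al.
exists l; apply/eqP; rewrite eq_le uF /=.
have alp : 0 < alpha 0 l by rewrite lt_def al al0.
(* All terms of the Lagrangian derivative other than the [l]-th objective are nonpositive, so that
   one is at least the whole sum. *)
rewrite -(pmulr_rge0 _ alp); apply: le_trans L0 _.
have -> : \sum_i mu 0 i * dot (grad (component h i) a) u = 0.
  by apply: big1 => i _; rewrite uh mulr0.
have G0 : \sum_i lambda 0 i * dot (grad (component g i) a) u <= 0.
  apply: sumr_le0 => i _; have /eqP := compl i.
  rewrite mulf_eq0 => /orP[/eqP->|/eqP/ug gi]; first by rewrite mul0r.
  by rewrite mulr_ge0_le0.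
have F0 : \sum_(i | i != l) alpha 0 i * dot (grad (component F i) a) u <= 0.
  by apply: sumr_le0 => i _; rewrite mulr_ge0_le0.
rewrite (bigD1 l)//= addr0; lra.
Qed.

End Multipliers.

(** * Second-order sufficiency: contradiction from a failure of quadratic growth *)

Theorem theorem5p1 (R : realType) (n s d p q : nat)
  (F : 'rV[R]_n -> 'rV[R]_d.+1) (g : 'rV[R]_n -> 'rV[R]_p)
  (h : 'rV[R]_n -> 'rV[R]_q) (xbar : 'rV[R]_n)
  (alpha : 'rV[R]_d.+1) (lambda : 'rV[R]_p) (mu : 'rV[R]_q)
  (hs : (0 < s < n)%N)
  (hxbar : Omega_set s g h xbar)
  (hF : C11_around_vec F xbar)
  (hg : C11_around_vec g xbar)
  (hh : C11_around_vec h xbar)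
  (hstat : S_stationary s F g h xbar)
  (hmult : S_multipliers s F g h xbar (alpha, lambda, mu))
  (hsecond : forall u : 'rV[R]_n,
     ((contingent_cone (Omega_set s g h) xbar `&`
       critical_cone F g h xbar) `\ (0 : 'rV[R]_n)) u ->
     forall z : 'rV[R]_n,
       subdiff2 (LM F g h alpha lambda mu) xbar u z -> 0 < dot z u) :
  isolated_local_efficient2 F (Omega_set s g h) xbar.
Proof.
apply: contrapT => notiso.
have [[galam hxbar0] sbar] := hxbar.
have [[al0 aln] la0 normal compl] := hmult.
have {hF}CF i := C11_around_near (hF i).
have {hg}Cg i := C11_around_near (hg i).
have {hh}Ch i := C11_around_near (hh i).
have dF i := C11_near_differentiable (CF i).
have dg i := C11_near_differentiable (Cg i).
have dh i := C11_near_differentiable (Ch i).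
pose psi := LM F g h alpha lambda mu.
have Cpsi : C11_near psi xbar := C11_near_LM alpha lambda mu CF Cg Ch.
have [M [r [M0 r0 hM]]] := small_second_difference Cpsi.
(* Negated growth with constant [2 * e] on the ball of radius [e]; the factor [n] converts the
   Euclidean norm to the max norm. *)
have bad (e : R) : 0 < e -> exists x, [/\ Omega_set s g h x, `|x - xbar| < e,
    x != xbar & forall l, F x 0 l - F xbar 0 l <= e * n%:R * `|x - xbar| ^+ 2].
  move=> e0; apply: contrapT => none; apply: notiso; exists (2 * e).
    by rewrite mulr_gt0.
  exists (ball xbar e); first exact: nbhsx_ballx.
  move=> x [Ox xe]; rewrite leNgt; apply/negP => lt_x; apply: none.
  have mi0 : max_increment F xbar xbar <= 0.
    by apply/bigmax_leP; rewrite subrr; split => // l _; rewrite subrr.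
  have lex l : F x 0 l - F xbar 0 l <= max_increment F xbar x.
    exact: (le_bigmax _ (fun l => F x 0 l - F xbar 0 l)).
  exists x; split => //.
  - by move: xe; rewrite -ball_normE /= distrC.
  - apply: contraTneq lt_x => ->; rewrite -leNgt subrr.
    by rewrite /enorm dot0l sqrtr0 expr0n /= mulr0 addr0.
  - move=> l; apply: le_trans (lex l) (le_trans (ltW lt_x) _).
    have : e * enorm (x - xbar) ^+ 2 <= e * (n%:R * `|x - xbar| ^+ 2).
      by rewrite ler_pM2l// enorm_sqr_le.
    have -> : 2^-1 * (2 * e) = e by rewrite mulrA mulVf// mul1r.
    lra.
(* Approximate counterexample of tolerance [e]: a feasible direction [uv.1] and a subgradient [uv.2]
   at a nearby [c]. Every tolerance is monotone in [e], as [compact_extraction] requires. *)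
pose P (e : R) (uv : 'rV[R]_n * 'rV[R]_n) := exists t c,
  [/\ [/\ 0 < t, t < e, `|c - xbar| < e & differentiable psi c],
      Omega_set s g h (xbar + t *: uv.1) /\
        forall l, F (xbar + t *: uv.1) 0 l - F xbar 0 l <= e * t,
      0 <= dot (grad psi xbar) uv.1,
      `|grad psi c - grad psi xbar| < e /\ dot uv.2 uv.1 <= e &
      frechet_normal_cone (gph_grad psi)
        (row_mx c (grad psi c)) (row_mx uv.2 (- uv.1))].
pose A : set ('rV[R]_n * 'rV[R]_n) := [set u | `|u| = 1] `*` [set v | `|v - 0| <= M].
have cA : compact A.
  apply: compact_setX; last exact: compact_norm_ball.
  apply: (@subclosed_compact _ _ _ _ (@compact_norm_ball R n 0 1)); last first.
    by move=> u /=; rewrite subr0 => ->.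
  rewrite (_ : [set u | _] = Num.Def.normr @^-1` [set 1])//.
  by apply: (preimage_closed _ (@closed_eq _ 1)) => u _; exact: norm_continuous.
have mono e e' uv : e <= e' -> P e uv -> P e' uv.
  move=> ee [t [c [[t0 te ce dc] [Ot Ft] L0 [ge vu] nc]]].
  exists t, c; split => //.
  - by split => //; apply: lt_le_trans ee.
  - by split => // l; apply: le_trans (Ft l) _; rewrite ler_wpM2r// ltW.
  - by split; [exact: lt_le_trans ee|exact: le_trans ee].
have exP e : 0 < e -> exists2 uv, A uv & P e uv.
  move=> e0.
  pose S := \sum_i alpha 0 i.
  have S0 : 0 <= S by apply: sumr_ge0 => i _; exact: al0.
  (* The summands cover, in units of [e1], the bound on [dot v u], the objective increments and the
     gradient gap; the last 1 gives strictness and [e1 <= e]. *)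
  pose D : R := 3 * (S * n%:R + 1) + n%:R + M + 1.
  have Sn0 : 0 <= S * n%:R by rewrite mulr_ge0.
  have n0 : 0 <= n%:R :> R by [].
  have D0 : 0 < D by rewrite /D; lra.
  have /nbhs_normP[rho /= rho0 seg] := sparse_segment s xbar.
  pose e1 := Num.min (Num.min 1 r) (Num.min rho (e / D)).
  have e10 : 0 < e1 by rewrite !lt_min ltr01 r0 rho0 divr_gt0.
  have e11 : e1 <= 1 by rewrite !ge_min lexx.
  have e1r : e1 <= r by rewrite !ge_min lexx orbT.
  have e1rho : e1 <= rho by rewrite !ge_min lexx !orbT.
  have e1D : e1 * D <= e by rewrite -ler_pdivlMr// !ge_min lexx !orbT.
  have [x [[Phix sx] xe xn Fx]] := bad e1 e10.
  pose t := `|x - xbar|; have t0 : 0 < t by rewrite normr_gt0 subr_eq0.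
  pose u := t^-1 *: (x - xbar).
  have tu : t *: u = x - xbar by rewrite scalerA divff ?gt_eqF// scale1r.
  have u1 : `|u| = 1 by rewrite normrZ gtr0_norm ?invr_gt0// mulVf ?gt_eqF.
  have xE : xbar + t *: u = x by rewrite tu subrKC.
  have D1 : e1 * 1 <= e1 * D by rewrite ler_pM2l// /D; lra.
  have tlee : t < e by apply: lt_le_trans xe _; lra.
  (* S-stationarity enters here: minus the gradient is normal to the sparse set, which contains the
     segment to [x]. *)
  have L0 : 0 <= dot (grad psi xbar) (x - xbar).
    rewrite -oppr_le0 -dotNl; apply: (frechet_normal_segment normal).
    by apply: seg => //; rewrite /= distrC; apply: lt_le_trans xe e1rho.
  have L0u : 0 <= dot (grad psi xbar) u.
    by rewrite dotZr mulr_ge0// invr_ge0 ltW.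
  (* The first term bounds the increment of the Lagrangian; the added [e1] ensures positivity. *)
  pose E := S * (e1 * n%:R) + e1.
  have E0 : 0 < E by rewrite /E ltr_wpDl// !mulr_ge0// ltW.
  have incr : psi (xbar + t *: u) - psi xbar - t * dot (grad psi xbar) u <= E * t ^+ 2.
    rewrite xE; have := LM_increment_le mu al0 la0 compl (conj galam hxbar0) Phix Fx.
    rewrite -/psi -/t -/S => h1.
    have h2 : 0 <= t * dot (grad psi xbar) u by rewrite mulr_ge0// ltW.
    have h3 : 0 <= e1 * t ^+ 2 by rewrite mulr_ge0 ?exprn_ge0 ?(ltW e10) ?(ltW t0).
    rewrite /E; lra.
  have tr : 0 < t < r by rewrite t0 (lt_le_trans xe).
  have [c [v [[cx dc] gc vM vu nc]]] := hM u t E u1 tr E0 incr.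
  exists (u, v); first by split => //=; rewrite subr0.
  exists t, c; split => //=.
  - by split => //; apply: lt_trans tlee.
  - rewrite xE; split => // l; apply: le_trans (Fx l) _.
    rewrite -/t expr2 mulrA ler_pM2r//.
    apply: (@le_trans _ _ (e1 * n%:R)).
      by rewrite -[leRHS]mulr1 ler_wpM2l ?mulr_ge0 ?(ltW e10)// ltW// (lt_le_trans xe).
    by apply: le_trans e1D; rewrite ler_pM2l// /D; lra.
  - split.
      apply: le_lt_trans gc _; apply: lt_le_trans e1D.
      apply: (@le_lt_trans _ _ (M * e1)); first by rewrite ler_wpM2l// ltW.
      by rewrite mulrC ltr_pM2l// /D; lra.
    apply: le_trans vu _; apply: le_trans e1D.
    have -> : 3 * E = e1 * (3 * (S * n%:R + 1)) by rewrite /E; ring.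
    by rewrite ler_pM2l// /D; lra.
have [[u z] [/= u1 _] [y ycv yP]] := compact_extraction cA mono exP.
have /choice[t /choice[c hk]] := yP.
have uk : (fun k => (y k).1) @ \oo --> u by apply: (cvg_comp y fst ycv); exact: cvg_fst.
have vk : (fun k => (y k).2) @ \oo --> z by apply: (cvg_comp y snd ycv); exact: cvg_snd.
have tk k : 0 < t k < k.+1%:R^-1 by have [[-> -> _ _] _ _ _ _] := hk k.
have lim_inv : (fun k => k.+1%:R^-1 : R) @ \oo --> (0 : R) := cvg_harmonic.
have critical : critical_cone F g h xbar u.
  apply: (@critical_direction _ _ _ _ _ F g h xbar alpha lambda mu) => //.
  - move=> l; apply: (first_order_sign_seq (dF l) tk uk) => k.
    by have [_ [_ Fk] _ _ _] := hk k; apply: Fk.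
  - move=> i gi; apply: (first_order_sign_seq (dg i) tk uk) => k.
    have [_ [[[gk _] _] _] _ _ _] := hk k.
    have /andP[t0 _] := tk k.
    rewrite /component gi subr0; apply: le_trans (gk i) _.
    by rewrite mulr_ge0// ?invr_ge0// ltW.
  - move=> j; have hz k : h (xbar + t k *: (y k).1) 0 j = 0.
      by have [_ [[[_ ->]]]] := hk k.
    have rhs k : 0 <= k.+1%:R^-1 * t k.
      by have /andP[t0 _] := tk k; rewrite mulr_ge0 ?invr_ge0// ltW.
    apply/eqP; rewrite eq_le; apply/andP; split.
      apply: (first_order_sign_seq (dh j) tk uk) => k.
      by rewrite /component hz hxbar0 subrr.
    (* The opposite inequality comes from the same lemma applied to [- h_j]. *)
    rewrite -oppr_le0 -dotNl -scaleN1r -gradZ//.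
    apply: (first_order_sign_seq (differentiableZ _ (dh j)) tk uk) => k.
    by rewrite !fctE /component hz hxbar0 subrr.
  - apply: (cvgr_to_ge (cvg_dot (cvg_cst (grad psi xbar)) uk)).
    by apply: nearW => k; have [] := hk k.
have un0 : u != 0 by rewrite -normr_eq0 u1 oner_eq0.
have tangent : contingent_cone (Omega_set s g h) xbar u.
  exists t, (fun k => (y k).1); split => //.
  - by move=> k; have /andP[] := tk k.
  - apply: cvg_inv_succ => k; have /andP[t0 tk1] := tk k.
    by rewrite subr0 gtr0_norm.
  - by move=> k; have [_ [Ok _] _ _ _] := hk k.
have zu : subdiff2 psi xbar u z.
  apply: (subdiff2_limit (ck := c) _ _ _ vk uk).
  - by move=> k; have [[]] := hk k.
  - by apply: cvg_inv_succ => k; have [[]] := hk k.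
  - by apply: cvg_inv_succ => k; have [_ _ _ []] := hk k.
  - by move=> k; have [] := hk k.
have /hsecond/(_ z zu) : ((contingent_cone (Omega_set s g h) xbar `&`
    critical_cone F g h xbar) `\ (0 : 'rV[R]_n)) u by split => //; apply/eqP.
(* [dot z u] is the limit of [dot v_k u_k], which is at most [1/(k+1)]. *)
rewrite ltNge => /negP; apply.
apply: (ler_cvg_to (cvg_dot vk uk) lim_inv).
by apply: nearW => k; have [_ _ _ []] := hk k.
Qed.
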